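(* Consider the shear flow $\mathbf v_{sh}=(s(x_2),0)$ in $\Omega=\mathbb R\times(-1,1)$, where $s\in C^2([-1,1])$. (i) Assume $\min_{[-1,1]}s''>0$. Suppose that $\mathbf V(t;x)=\mathbf v(x_1-ct,x_2)$ is a travelling wave solution to the time-dependent Euler system $$\partial_t\mathbf V+\mathbf V\cdot\nabla\mathbf V+\nabla\Pi=0,\qquad \operatorname{div}\mathbf V=0,\qquad t\in\mathbb R,\ x\in\Omega,$$ where $c\in\mathbb R$ and the profile $\mathbf v=(v_1,v_2)\in C^2(\bar\Omega)\cap L^\infty(\Omega)$ satisfies the slip boundary condition $v_2=0$ on $\partial\Omega$. If $$\|\partial_{x_2}(\omega-\omega_{sh})\|_{L^\infty(\Omega)}<\min_{[-1,1]}s'',$$ where $\omega:=\partial_{x_1}v_2-\partial_{x_2}v_1$ and $\omega_{sh}=-s'$ are the vorticities of $\mathbf v$ and $\mathbf v_{sh}$, respectively, then $\mathbf v$ must be a shear flow. (ii) If $s$ has finitely many zeros in $[-1,1]$, and $s''(c)\ne0$ whenever $s(c)=0$, then the shear flow $\mathbf v_{sh}$ is structurally stable in $\Omega$ in the following sense: there exists a number $\varepsilon_0>0$ such that, for any solution $\mathbf v=(v_1,v_2)\in C^2(\bar\Omega)$ of the steady Euler system $$\mathbf v\cdot\nabla\mathbf v+\nabla P=0,\qquad\operatorname{div}\mathbf v=0\quad\text{in }\Omega$$ with $v_2=0$ on $\partial\Omega$, if $$\|v_1-s\|_{W^{2,\infty}(\Omega)}\le\varepsilon_0,$$ then $\mathbf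 v$ must be a shear flow.
   Context: $\Pi$ and $P$ denote the pressures (some scalar functions for which the equations hold). A shear flow in $\Omega$ with the slip boundary condition is a flow of the form $(v_1(x_2),0)$. In the expression $v_1-s$, $s$ is viewed as the function $x\mapsto s(x_2)$ on $\Omega$, and likewise for $\omega_{sh}$. *)

(* Defs.v *)
From HB Require Import structures.
From mathcomp Require Import all_boot all_order all_algebra.
From mathcomp Require Import all_classical all_reals all_analysis.

Set Implicit Arguments.
Unset Strict Implicit.
Unset Printing Implicit Defensive.

Import Order.TTheory GRing.Theory Num.Theory.
Import numFieldNormedType.Exports.

Local Open Scope classical_set_scope.
Local Open Scope ring_scope.

Section Strip.
Variable R : realType.
Implicit Types (f g P : R * R -> R) (x : R * R).

Definition Omega : set (R * R) := [set x | -1 < x.2 < 1].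

Definition Omega_bar : set (R * R) := [set x | -1 <= x.2 <= 1].

Definition bd_Omega : set (R * R) := [set x | x.2 = -1 \/ x.2 = 1].

(* [pd1] and [pd2] are total (with a junk value where the derivative does not
   exist) and two-sided; they are only used at points of the open strip. *)
Definition pd1 f : R * R -> R := fun x => derive1 (fun t : R => f (t, x.2)) x.1.

Definition pd2 f : R * R -> R := fun x => derive1 (fun t : R => f (x.1, t)) x.2.

Definition pderivable f x : Prop :=
  derivable (fun t : R => f (t, x.2)) x.1 1 /\
  derivable (fun t : R => f (x.1, t)) x.2 1.

Definition extends_continuously g : Prop :=
  exists h : R * R -> R,
    {within Omega_bar, continuous h} /\ (forall x, Omega x -> h x = g x).

Definition C1_up_to_boundary f : Prop :=
  [/\ forall x, Omega x -> pderivable f x,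
      extends_continuously (pd1 f) & extends_continuously (pd2 f)].

(* C^2 of the closed strip: the function is continuous on the closed strip and
   its partial derivatives of order 1 and 2 exist in the open strip and extend
   continuously to the closed one.  No boundedness is required. *)
Definition C2_closed_strip f : Prop :=
  [/\ {within Omega_bar, continuous f},
      C1_up_to_boundary f,
      C1_up_to_boundary (pd1 f) & C1_up_to_boundary (pd2 f)].

(* s is in C^2([-1,1]) with first and second derivatives s1 and s2; the values
   of s1 and s2 at -1 and 1 are the limits from inside, that is, the one-sided
   derivatives. *)
Definition C2_segment (s s1 s2 : R -> R) : Prop :=
  [/\ {within `[-1, 1], continuous s},
      {within `[-1, 1], continuous s1},
      {within `[-1, 1], continuous s2},
      forall y : R, -1 < y < 1 -> is_derive y 1 s (s1 y) &
      forall y : R, -1 < y < 1 -> is_derive y 1 s1 (s2 y)].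

(* For f continuous on [-1,1] this infimum is attained. *)
Definition min_segment (f : R -> R) : R := inf [set f y | y in `[-1, 1]].

(* L^oo(Omega) norm: essential supremum of |f| over Omega for the
   two-dimensional Lebesgue measure. *)
Definition Linf_norm f : \bar R :=
  'N[(@lebesgue_measure R \x @lebesgue_measure R)%E]_+oo%E
    [EFin \o (f \_ Omega)].

(* W^{2,oo}(Omega) norm of a function of class C^2, whose weak derivatives are
   its classical ones. *)
Definition W2inf_norm f : \bar R :=
  (Linf_norm f + Linf_norm (pd1 f) + Linf_norm (pd2 f)
   + Linf_norm (pd1 (pd1 f)) + Linf_norm (pd2 (pd1 f))
   + Linf_norm (pd2 (pd2 f)))%E.

Definition vorticity (v1 v2 : R * R -> R) : R * R -> R :=
  fun x => pd1 v2 x - pd2 v1 x.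

Definition div_free (v1 v2 : R * R -> R) : Prop :=
  forall x, Omega x -> pd1 v1 x + pd2 v2 x = 0.

Definition slip (v2 : R * R -> R) : Prop := forall x, bd_Omega x -> v2 x = 0.

Definition steady_euler (v1 v2 : R * R -> R) : Prop :=
  div_free v1 v2 /\
  exists P, forall x, Omega x ->
    [/\ pderivable P x,
        v1 x * pd1 v1 x + v2 x * pd2 v1 x + pd1 P x = 0 &
        v1 x * pd1 v2 x + v2 x * pd2 v2 x + pd2 P x = 0].

Definition unsteady_euler (V1 V2 : R -> R * R -> R) : Prop :=
  (forall t, div_free (V1 t) (V2 t)) /\
  exists Pi : R -> R * R -> R, forall t x, Omega x ->
    [/\ pderivable (Pi t) x,
        derive1 (fun r : R => V1 r x) t
          + (V1 t x * pd1 (V1 t) x + V2 t x * pd2 (V1 t) x)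
          + pd1 (Pi t) x = 0 &
        derive1 (fun r : R => V2 r x) t
          + (V1 t x * pd1 (V2 t) x + V2 t x * pd2 (V2 t) x)
          + pd2 (Pi t) x = 0].

Definition travelling (c : R) f : R -> R * R -> R :=
  fun t x => f (x.1 - c * t, x.2).

Definition shear_flow (v1 v2 : R * R -> R) : Prop :=
  exists g : R -> R, forall x, Omega_bar x -> v1 x = g x.2 /\ v2 x = 0.

End Strip.

(* Main.v *)
Require Import Defs.
From HB Require Import structures.
From mathcomp Require Import all_boot all_order all_algebra.
From mathcomp Require Import all_classical all_reals all_analysis.
From mathcomp Require Import ess_sup_inf ring lra.

Set Implicit Arguments.
Unset Strict Implicit.
Unset Printing Implicit Defensive.

Import Order.TTheory GRing.Theory Num.Theory.
Import numFieldNormedType.Exports.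

Local Open Scope classical_set_scope.
Local Open Scope ring_scope.

(** Both parts reduce to one statement about a steady flow (w, v) of the strip,
    where w = v1 - c in the moving frame (c = 0 in the second part): if w and v
    are bounded and |w| + |lap w| >= m > 0, then v = 0 [steady_rigidity]. In the
    first part the hypothesis on the vorticity gives lap w >= m; in the second,
    |s| + |s''| is bounded below on the segment and a C^2-small perturbation of s
    inherits the bound.

    Put A = w grad v - v grad w. By incompressibility A is the rotated pressure
    gradient, hence div A = 0, which also reads w lap v = v lap w. At the zeros
    of w one has lap w <> 0, hence v = 0; quantitatively |v| <= K |w| locally
    [vertical_controlled]. The slope q = v / w is thus locally bounded and solves
    the degenerate elliptic equation div (w^2 grad q) = 0.

    Test this equation with q over the cross-sections: E(x) = int q A1 dy
    satisfies E' = int |A|^2 / w^2 =: S, while |q A1| <= M |A| / |w| for a bound M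
    of |v| gives E^2 <= 2 M^2 S. So E' >= kappa E^2 on the whole line, and such a
    function blows up in finite length unless it vanishes identically
    [riccati_blowup]; therefore S = 0 and A = 0. Since q is not differentiable
    at the zeros of w, the computation is done with v w k(w^2), where k is a
    regularization of 1 / u for which u (u k)' is uniformly small; this costs an
    arbitrarily small error in the Riccati inequality on each bounded interval
    [slow_regularization, flux_energy, riccati_liouville].

    Now the pressure gradient vanishes, and G(x) = int y w v dy satisfies
    G' = int v^2 and G^2 <= 2 M^2 G'. The same blow-up argument gives v = 0
    [vertical_velocity_eq0]. Then d1 v1 = - d2 v2 = 0 and the flow is a shear
    flow. *)

(** * Calculus on the line and blow-up of Riccati inequalities *)

Section RealCalculus.
Context {R : realType}.
Implicit Types (f g : R -> R) (x a b : R).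

Lemma is_derive_mul f g x a b :
  is_derive x 1 f a -> is_derive x 1 g b ->
  is_derive x 1 (fun t => f t * g t) (a * g x + f x * b).
Proof.
move=> fa gb; apply: is_derive_eq (is_deriveM fa gb) _.
by rewrite /GRing.scale/=; ring.
Qed.

Lemma is_derive_add f g x a b :
  is_derive x 1 f a -> is_derive x 1 g b ->
  is_derive x 1 (fun t => f t + g t) (a + b).
Proof. exact: is_deriveD. Qed.

Lemma is_derive_sub f g x a b :
  is_derive x 1 f a -> is_derive x 1 g b ->
  is_derive x 1 (fun t => f t - g t) (a - b).
Proof. exact: is_deriveB. Qed.

Lemma is_derive_continuous f x a : is_derive x 1 f a -> {for x, continuous f}.
Proof.
by move=> fa; apply/differentiable_continuous/derivable1_diffP; case: fa.
Qed.

Lemma is_derive_derive1 f x a : is_derive x 1 f a -> derive1 f x = a.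
Proof. by move=> fa; rewrite derive1E; apply: derive_val. Qed.

Lemma derivable_is_derive f x : derivable f x 1 -> is_derive x 1 f (derive1 f x).
Proof. by move=> fx; apply: DeriveDef => //; rewrite derive1E. Qed.

(** For a function that is derivable up to the end points, which spares its users
    the separate continuity hypothesis. *)
Lemma MVT_real (f df : R -> R) a b : a < b ->
  (forall x, a <= x <= b -> is_derive x 1 f (df x)) ->
  exists2 c, a < c < b & f b - f a = df c * (b - a).
Proof.
move=> ab fdf; have [||c cab ->] := @MVT R f df a b ab.
- move=> x; rewrite in_itv/= => /andP[ax xb].
  by apply: fdf; rewrite !ltW.
- apply: derivable_within_continuous => x; rewrite in_itv/= => xab.
  by case: (fdf _ xab).
- by exists c => //; rewrite in_itv/= in cab.
Qed.

End RealCalculus.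

Section RiccatiBlowUp.
Context {R : realType}.

(** On an interval on which E stays above e / 2 the error eta is absorbed by the
    quadratic term, so that E' >= kappa E^2 / 2 and 1 / E decreases at speed at
    least kappa / 2. Since 1 / E starts below 1 / e and remains positive, the
    interval cannot be longer than 2 / (kappa e). *)
Lemma riccati_blowup (E dE : R -> R) (kappa e eta a b : R) :
  0 < kappa -> 0 < e -> a < b ->
  eta * (b - a) <= e / 2 -> eta <= kappa * e ^+ 2 / 8 ->
  (forall x, a <= x <= b -> is_derive x 1 E (dE x)) ->
  (forall x, a <= x <= b -> - eta <= dE x) ->
  (forall x, a <= x <= b -> kappa * E x ^+ 2 - eta <= dE x) ->
  e <= E a -> kappa * e * (b - a) <= 2.
Proof.
move=> k0 e0 ab eta1 eta2 EdE dE1 dE2 eEa.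
(* The lower bound - eta on E' alone lets E lose at most e / 2. *)
have Ege x : a <= x <= b -> e / 2 <= E x.
  move=> /andP[]; rewrite le_eqVlt => /predU1P[<- _|ax xb]; first by lra.
  have [|c /andP[ac cx]] := @MVT_real R E dE a x ax.
    by move=> t /andP[at_ tx]; apply: EdE; rewrite at_ (le_trans tx).
  have := dE1 c; rewrite (ltW ac) (le_trans (ltW cx) xb) => /(_ isT) h H.
  have : - eta * (x - a) <= dE c * (x - a) by rewrite ler_wpM2r// subr_ge0 ltW.
  have [eta0|eta0] := leP 0 eta.
    have : eta * (x - a) <= eta * (b - a) by rewrite ler_wpM2l// lerB.
    lra.
  have : 0 < - eta * (x - a) by rewrite mulr_gt0 ?oppr_gt0 ?subr_gt0.
  lra.
pose F x := - (E x)^-1.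
have FdF x : a <= x <= b -> is_derive x 1 F (dE x / E x ^+ 2).
  move=> xab; have := Ege _ xab => Ex.
  have /lt0r_neq0 Ex0 : 0 < E x by lra.
  have D := EdE _ xab; rewrite /F.
  apply: is_derive_eq (is_deriveN (is_deriveV Ex0 D)) _.
  by rewrite /GRing.scale/= mulNr opprK mulrC.
have [c /andP[ac cb]] := MVT_real ab FdF; have cab : a <= c <= b by rewrite !ltW.
have := Ege _ cab => Ec; have Ec0 : 0 < E c by lra.
have : kappa / 2 <= dE c / E c ^+ 2.
  rewrite ler_pdivlMr ?exprn_gt0//.
  have := dE2 _ cab.
  have : kappa * (e / 2) ^+ 2 <= kappa * E c ^+ 2.
    by rewrite ler_wpM2l ?(ltW k0)// lerXn2r ?nnegrE//; lra.
  lra.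
rewrite /F => h H.
have : kappa / 2 * (b - a) <= dE c / E c ^+ 2 * (b - a).
  by rewrite ler_wpM2r// subr_ge0 ltW.
have Eb : 0 < (E b)^-1.
  by have := Ege b; rewrite (ltW ab) lexx invr_gt0 => /(_ isT); lra.
have Ea : (E a)^-1 <= e^-1 by rewrite lef_pV2 ?posrE// (lt_le_trans e0).
move=> h'; have {}H : kappa / 2 * (b - a) <= e^-1 by lra.
have : kappa / 2 * (b - a) * e <= e^-1 * e by rewrite ler_wpM2r ?(ltW e0).
rewrite mulVf ?gt_eqF//; lra.
Qed.

End RiccatiBlowUp.

(** * Integrals over the cross-sections of the strip *)

Section StripIntegral.
Context {R : realType}.
Notation mu := (@lebesgue_measure R).
Implicit Types (f g : R * R -> R) (x y : R).

(** The open interval, because differentiation under the integral sign asks for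
    derivatives at every point of the domain of integration, and those of the
    velocity are only available inside the strip. *)
Definition strip_int f x : R := (\int[mu]_(y in `]-1, 1[) f (x, y))%R.

Lemma continuous_vslice f x : continuous f -> continuous (fun y => f (x, y)).
Proof.
move=> cf y; apply: (@continuous_comp _ _ _ (fun t : R => (x, t)) f).
  by apply: (@cvg_pair _ _ _ _ (nbhs x) (nbhs y)); [exact: cvg_cst|exact: cvg_id].
exact: cf.
Qed.

Lemma vslice_integrable f x (i : interval R) : [set` i] `<=` `[-1, 1] ->
  continuous f -> mu.-integrable [set` i] (EFin \o (fun y => f (x, y))).
Proof.
move=> i11 cf.
have int11 : mu.-integrable `[-1, 1] (EFin \o (fun y => f (x, y))).
  apply: continuous_compact_integrable; first exact: segment_compact.
  exact/continuous_subspaceT/continuous_vslice.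
refine (integrableS _ _ _ int11) => //; exact: measurable_itv.
Qed.

Let sub_oo : [set` `](-1)%R, 1%R[ : interval R] `<=` `[-1, 1].
Proof. exact: subset_itv_oo_cc. Qed.

Let oo_integrable f x := @vslice_integrable f x `]-1, 1[ sub_oo.

Lemma eq_strip_int f g x : (forall y, -1 < y < 1 -> f (x, y) = g (x, y)) ->
  strip_int f x = strip_int g x.
Proof.
move=> fg; apply: eq_Rintegral => y; rewrite inE/= in_itv/=; exact: fg.
Qed.

Lemma strip_intD f g x : continuous f -> continuous g ->
  strip_int (fun p => f p + g p) x = strip_int f x + strip_int g x.
Proof. by move=> cf cg; apply: RintegralD => //; apply: oo_integrable. Qed.

Lemma strip_intZ c f x : continuous f ->
  strip_int (fun p => c * f p) x = c * strip_int f x.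
Proof. by move=> cf; apply: RintegralZl => //; exact: oo_integrable. Qed.

Lemma strip_int_cst c x : strip_int (fun=> c) x = c * 2.
Proof.
rewrite /strip_int Rintegral_cst//= lebesgue_measure_itv/= lte_fin.
by rewrite ifT//=; lra.
Qed.

Lemma le_strip_int f g x : continuous f -> continuous g ->
  (forall y, -1 < y < 1 -> f (x, y) <= g (x, y)) ->
  strip_int f x <= strip_int g x.
Proof.
move=> cf cg fg; apply: le_Rintegral.
- exact: measurable_itv.
- exact: (oo_integrable x cf).
- exact: (oo_integrable x cg).
by move=> y; rewrite /= in_itv/=; exact: fg.
Qed.

(** Cauchy-Schwarz on an interval of length 2: expand the integral of
    (f - I / 2)^2 >= 0, where I / 2 is the mean of f. *)
Lemma sqr_strip_int_le f x : continuous f ->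
  strip_int f x ^+ 2 <= 2 * strip_int (fun p => f p ^+ 2) x.
Proof.
move=> cf; set I := strip_int f x.
have cf2 : continuous (fun p => f p ^+ 2).
  by move=> p; apply: (@continuousM _ _ f f); exact: cf.
have cc (a : R) : continuous (fun _ : R * R => a) by move=> p; exact: cvg_cst.
have cZ a : continuous (fun p => a * f p).
  by move=> p; apply: (@continuousM _ _ (fun=> a) f); [exact: cc|exact: cf].
have cD : continuous (fun p => - I * f p + (I / 2) ^+ 2).
  by move=> p; apply: (@continuousD _ _ _ (fun p => _ * f p) (fun=> _));
    [exact: cZ|exact: cc].
have : strip_int (fun=> 0) x <=
       strip_int (fun p => f p ^+ 2 + (- I * f p + (I / 2) ^+ 2)) x.
  apply: le_strip_int; first exact: cc.
    move=> p; apply: (@continuousD _ _ _ (fun p => f p ^+ 2)); [exact: cf2|].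
    exact: cD.
  move=> y _; rewrite [leRHS](_ : _ = (f (x, y) - I / 2) ^+ 2) ?sqr_ge0//.
  by field.
rewrite strip_intD// strip_intD// strip_intZ// !strip_int_cst mul0r -/I.
lra.
Qed.

Lemma box_bounded f : continuous f -> forall L,
  exists2 B : R, 0 <= B & forall x y, `|x| <= L -> `|y| <= 1 -> `|f (x, y)| <= B.
Proof.
move=> cf L; have [L0|L0] := leP 0 L; last first.
  by exists 0 => // x y; have := normr_ge0 x; lra.
have [|||c _ fc] := @compact_EVT_max _ R (fun p => `|f p|) (`[-L, L] `*` `[-1, 1]).
- by exists (0, 0); split => /=; rewrite in_itv/=; apply/andP; lra.
- by apply: compact_setX; exact: segment_compact.
- apply: continuous_subspaceT => p.
  by apply: (@continuous_comp _ _ _ f (fun z : R => `|z|)); [exact: cf|exact: norm_continuous].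
exists `|f c| => // x y xL y1; apply: fc; rewrite inE; split => /=.
  by rewrite in_itv/= -ler_norml.
by rewrite in_itv/= -ler_norml.
Qed.

(** The dominating function is a constant: g is bounded on the compact box
    [x - 1, x + 1] x [-1, 1]. *)
Lemma is_derive_strip_int f g : continuous f -> continuous g ->
  (forall x y, -1 < y < 1 -> is_derive x 1 (fun t => f (t, y)) (g (x, y))) ->
  forall x, is_derive x 1 (strip_int f) (strip_int g x).
Proof.
move=> cf cg fg x.
have [B B0 gB] := box_bounded cg (`|x| + 1).
pose G (_ : R) := B; have G0 y : 0 <= G y by [].
have d1E t y : -1 < y < 1 ->
    partial1of2 (fun x y => f (x, y)) t y = g (t, y).
  by move=> y1; rewrite /partial1of2; exact/is_derive_derive1/fg.
have xx : `]x - 1, x + 1[%classic x by rewrite /= in_itv/=; apply/andP; lra.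
have intf t : `]x - 1, x + 1[%classic t ->
    mu.-integrable `]-1, 1[ (EFin \o (fun y => f (t, y))).
  by move=> _; exact: oo_integrable.
have df t y : `]x - 1, x + 1[%classic t -> `]-1, 1[%classic y ->
    derivable (fun t => f (t, y)) t 1.
  by rewrite /= !in_itv/= => _ y1; case: (fg t y y1).
have G_ub t y : `]x - 1, x + 1[%classic t -> `]-1, 1[%classic y ->
    `|partial1of2 (fun x y => f (x, y)) t y| <= G y.
  rewrite /= !in_itv/= => tx y1; rewrite d1E// gB//.
    have := ler_norm x; have := ler_norm (- x); rewrite normrN => ? ?.
    by rewrite ler_norml; lra.
  by rewrite ler_norml; lra.
have intG : mu.-integrable `]-1, 1[ (EFin \o G).
  have := @oo_integrable (fun=> B) x; apply.
  by move=> p; exact: cvg_cst.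
apply: DeriveDef.
  exact: (@derivable_under_integral _ _ _ mu _ _
    (measurable_itv _) _ _ _ xx intf df _ G0 intG G_ub).
rewrite -derive1E.
rewrite [LHS](@differentiation_under_integral _ _ _ mu _ _
    (measurable_itv _) _ _ _ xx intf df _ G0 intG G_ub).
by apply: eq_Rintegral => y; rewrite inE/= in_itv/= => y1; exact: d1E.
Qed.

(** Fluxes through the walls vanish: this is the only form in which the boundary
    condition enters the integral identities. *)
Lemma strip_int_dy (F g : R * R -> R) x : continuous F -> continuous g ->
  F (x, -1) = 0 -> F (x, 1) = 0 ->
  (forall y, -1 < y < 1 -> is_derive y 1 (fun t => F (x, t)) (g (x, y))) ->
  strip_int g x = 0.
Proof.
move=> cF cg F0 F1 Fg; rewrite /strip_int.
rewrite Rintegral_itv_bndo_bndc; last exact: oo_integrable.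
rewrite Rintegral_itv_obnd_cbnd; last first.
  by apply: vslice_integrable => //; exact: subset_itv_oc_cc.
rewrite /Rintegral (@continuous_FTC2 _ _ (fun y => F (x, y))) ?F0 ?F1//=.
- by rewrite subrr.
- exact/continuous_subspaceT/continuous_vslice.
- split.
  + by move=> y; rewrite in_itv/= => y1; case: (Fg y y1).
  + by apply: cvg_at_right_filter; exact: continuous_vslice.
  + by apply: cvg_at_left_filter; exact: continuous_vslice.
- by move=> y; rewrite in_itv/= => y1; exact/is_derive_derive1/Fg.
Qed.

(** Uniformity in x is what matters: it turns a single point where f > 0 into a
    definite growth over an interval for any function whose derivative dominates
    the integral of f. *)
Lemma strip_int_gt0 f x0 y0 : continuous f ->
  (forall x y, -1 < y < 1 -> 0 <= f (x, y)) ->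
  -1 < y0 < 1 -> 0 < f (x0, y0) ->
  exists r c, [/\ 0 < r, 0 < c &
    forall x, x0 - r <= x <= x0 + r -> c <= strip_int f x].
Proof.
move=> cf f0 y01 fp; set m := f (x0, y0) / 2.
have m0 : 0 < m by rewrite divr_gt0.
have : \forall p \near (x0, y0), m < f p.
  have cfp : f p @[p --> (x0, y0)] --> f (x0, y0) by exact: cf.
  by apply: (cvgr_gt _ cfp); rewrite /m; lra.
move=> /nbhs_ballP[e /= e0 be].
pose r := Num.min (e / 2) (Num.min ((1 - y0) / 2) ((1 + y0) / 2)).
have r0 : 0 < r by rewrite /r !lt_min; apply/and3P; split; lra.
have [re ry ry'] : [/\ r < e, y0 + r < 1 & -1 < y0 - r].
  have : r <= e / 2 by rewrite /r ge_min lexx.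
  have : r <= (1 - y0) / 2 by rewrite /r !ge_min lexx orbT.
  have : r <= (1 + y0) / 2 by rewrite /r !ge_min lexx !orbT.
  by move=> *; split; lra.
exists r, (m * (2 * r)); split=> [//||x xr].
  by rewrite !mulr_gt0.
pose J := `[y0 - r, y0 + r].
have sJ : [set` J] `<=` `]-1, 1[.
  by move=> y; rewrite /= !in_itv/= => /andP[? ?]; apply/andP; lra.
have sJ' : [set` J] `<=` `[-1, 1].
  by apply: subset_trans sJ _; exact: sub_oo.
rewrite [leLHS](_ : _ = (\int[mu]_(y in [set` J]) m)%R); last first.
  rewrite Rintegral_cst//= lebesgue_measure_itv/= lte_fin ifT/=; last by lra.
  by congr (_ * _); lra.
have intJ : mu.-integrable [set` J] (EFin \o (fun y => f (x, y))).
  exact: vslice_integrable.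
apply: (@le_trans _ _ (\int[mu]_(y in [set` J]) f (x, y))%R).
  apply: le_Rintegral => //.
    have := @vslice_integrable (fun=> m) x J sJ'; apply.
    by move=> p; exact: cvg_cst.
  move=> y; rewrite /= in_itv/= => yJ; apply/ltW/be.
  by split; rewrite /ball/= /ball/= ltr_norml; lra.
rewrite /strip_int /Rintegral fine_le//.
- by apply: integrable_fin_num => //.
- by apply: integrable_fin_num => //; exact: oo_integrable.
- apply: ge0_subset_integral => //.
    exact: (measurable_int mu (oo_integrable _ cf)).
  by move=> y; rewrite /= in_itv/= lee_fin; exact: f0.
Qed.

End StripIntegral.

(** * A Liouville principle and a slow regularization of the inverse *)

Section Liouville.
Context {R : realType}.

(** If f were positive somewhere, each E would grow by a fixed amount 2 e across
    a fixed interval, hence E >= e at its right end or E <= - e at its left end.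
    In either case the Riccati inequality, read forwards or backwards, makes E
    blow up after a length of order 1 / (kappa e), independent of L and eta; a
    large L then gives a contradiction. The error eta may be chosen after L,
    which is why functions E that depend on both are good enough. *)
Lemma riccati_liouville (f : R * R -> R) (kappa : R) : 0 < kappa ->
  continuous f -> (forall x y, -1 < y < 1 -> 0 <= f (x, y)) ->
  (forall L eta : R, 0 < eta -> exists E dE : R -> R,
     (forall x : R, is_derive x 1 E (dE x)) /\
     forall x, `|x| <= L -> strip_int f x - eta <= dE x /\
                            kappa * E x ^+ 2 - eta <= dE x) ->
  forall x y, -1 < y < 1 -> f (x, y) = 0.
Proof.
move=> k0 cf f0 energy x0 y0 y01; apply/eqP; rewrite eq_le f0// andbT leNgt.
apply/negP => fp; have [r [c [r0 c0 fc]]] := strip_int_gt0 cf f0 y01 fp.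
have [e eE] : exists e, e = r * c / 2 by exists (r * c / 2).
have e0 : 0 < e by rewrite eE divr_gt0// mulr_gt0.
(* Longer than the blow-up length 2 / (kappa e). *)
pose T := 3 / (kappa * e).
have ke0 : 0 < kappa * e by rewrite mulr_gt0.
have T0 : 0 < T by rewrite divr_gt0.
have keT : kappa * e * T = 3 by rewrite mulrC divfK ?gt_eqF.
pose eta := Num.min (c / 2) (Num.min (e / (2 * T)) (kappa * e ^+ 2 / 8)).
have eta0 : 0 < eta.
  rewrite !lt_min; apply/and3P; split; first by lra.
    by rewrite divr_gt0// mulr_gt0.
  by rewrite divr_gt0// mulr_gt0// exprn_gt0.
have etac : eta <= c / 2 by rewrite /eta ge_min lexx.
have etaT : eta * T <= e / 2.
  have : eta <= e / (2 * T) by rewrite /eta !ge_min lexx orbT.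
  by rewrite invfM mulrA ler_pdivlMr.
have etak : eta <= kappa * e ^+ 2 / 8 by rewrite /eta !ge_min lexx !orbT.
clearbody eta T.
have [E [dE [EdE dEge]]] := energy (`|x0| + r + T) eta eta0.
have x0L : - `|x0| <= x0 <= `|x0| by rewrite -ler_norml.
have range x : x0 - r - T <= x <= x0 + r + T -> `|x| <= `|x0| + r + T.
  by move=> /andP[? ?]; rewrite ler_norml; lra.
have dE1 x : x0 - r - T <= x <= x0 + r + T -> - eta <= dE x.
  move=> xT; have [+ _] := dEge _ (range _ xT).
  suff : 0 <= strip_int f x by lra.
  apply: Rintegral_ge0 => y; rewrite /= in_itv/=; exact: f0.
have dE2 x : x0 - r - T <= x <= x0 + r + T -> kappa * E x ^+ 2 - eta <= dE x.
  by move=> xT; case: (dEge _ (range _ xT)).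
have rT : x0 - r < x0 + r by lra.
have [t /andP[tr tr'] Er] := MVT_real rT (fun x _ => EdE x).
have dEt : c / 2 <= dE t.
  have tT : x0 - r - T <= t <= x0 + r + T by apply/andP; split; lra.
  have tr'' : x0 - r <= t <= x0 + r by apply/andP; split; lra.
  by have [+ _] := dEge t (range _ tT); have := fc t tr''; lra.
have Eincr : r * c <= E (x0 + r) - E (x0 - r).
  rewrite Er; have : c / 2 * (x0 + r - (x0 - r)) <= dE t * (x0 + r - (x0 - r)).
    by rewrite ler_wpM2r//; lra.
  lra.
have [Ep|En] : e <= E (x0 + r) \/ e <= - E (x0 - r) by lra.
  have := @riccati_blowup R E dE kappa e eta (x0 + r) (x0 + r + T) k0 e0.
  have -> : x0 + r + T - (x0 + r) = T by lra.
  rewrite keT => blow.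
  suff : 3 <= 2 :> R by lra.
  apply: blow => //; first by lra.
  - by move=> x /andP[? ?]; apply: dE1; apply/andP; split; lra.
  - by move=> x /andP[? ?]; apply: dE2; apply/andP; split; lra.
(* The reflection x |-> - x turns blow-up to the left into blow-up to the right. *)
pose F x := - E (- x); pose dF x := dE (- x).
have FdF (x : R) : is_derive x 1 F (dF x).
  have D : is_derive x 1 (fun t : R => - t) (-1).
    exact: is_deriveN (is_derive_id x 1).
  apply: is_derive_eq (is_deriveN (is_derive1_comp (EdE (- x)) D)) _.
  by rewrite mulrN1 opprK.
have := @riccati_blowup R F dF kappa e eta (r - x0) (r - x0 + T) k0 e0.
have -> : r - x0 + T - (r - x0) = T by lra.
rewrite keT => blow.
suff : 3 <= 2 :> R by lra.
apply: blow => //; first by lra.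
- by move=> x /andP[? ?]; apply: dE1; apply/andP; split; lra.
- by move=> x /andP[? ?]; rewrite /F sqrrN; apply: dE2; apply/andP; split; lra.
- by rewrite /F opprB.
Qed.

End Liouville.

Section SlowRegularization.
Context {R : realType}.

(* With a = 2^-i and h_i(u) = u / (u + 2^-i), the terms of k are 1 / (u + a) and
   those of u (k + u k') are u a / (u + a)^2 <= 2 (h_(i+1) - h_i): their sum
   telescopes and stays below 2 while k itself grows like N / u. *)
Let dyadic_sum (N : nat) : exists k dk : R -> R, forall u : R, 0 <= u ->
  [/\ is_derive u 1 k (dk u), {for u, continuous dk},
      N%:R / (1 + u) <= k u, u * k u <= N%:R &
      0 <= k u + u * dk u /\ u * (k u + u * dk u) <= 2 * (u / (u + 2 ^- N))].
Proof.
elim: N => [|N [k [dk kdk]]].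
  exists (fun=> 0), (fun=> 0) => u u0; split.
  - exact: is_derive_cst.
  - exact: cvg_cst.
  - by rewrite mul0r.
  - by rewrite mulr0.
  - rewrite mulr0 addr0 mulr0; split => //.
    by rewrite mulr_ge0// divr_ge0// addr_ge0// invr_ge0 exprn_ge0.
pose a : R := 2 ^- N.
have a0 : 0 < a by rewrite /a invr_gt0 exprn_gt0.
have a1 : a <= 1 by rewrite /a invf_le1 ?exprn_gt0// exprn_ege1//; lra.
have aS : 2 ^- N.+1 = a / 2 :> R by rewrite exprS invfM mulrC.
exists (fun u => k u + (u + a)^-1), (fun u => dk u - (u + a) ^- 2) => u u0.
have [kD dkC k1 uk [kdk0 kdkN]] := kdk u u0; have ua0 : 0 < u + a by lra.
have Da : is_derive u 1 (fun t => t + a) 1.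
  apply: is_derive_eq (is_derive_add (is_derive_id u 1) (is_derive_cst a u 1)) _.
  by rewrite addr0.
have sqE : u * ((u + a)^-1 - u * (u + a) ^- 2) = u * a / (u + a) ^+ 2.
  by field; rewrite gt_eqF.
have sq0 : 0 <= (u + a)^-1 - u * (u + a) ^- 2.
  rewrite (_ : _ - _ = a / (u + a) ^+ 2); last by field; rewrite gt_eqF.
  by rewrite divr_ge0 ?ltW// exprn_gt0.
split.
- apply: is_derive_add => //.
  apply: is_derive_eq (is_deriveV _ Da) _; first by rewrite gt_eqF.
  by rewrite /GRing.scale/= mulr1.
- apply: (@continuousB _ _ _ dk (fun u => (u + a) ^- 2)) => //.
  apply: (@continuousV _ _ (fun u => (u + a) ^+ 2)); first by rewrite gt_eqF ?exprn_gt0.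
  have Ca := is_derive_continuous Da.
  exact: (@continuousM _ _ (fun t => t + a) (fun t => t + a)).
- rewrite -natr1 mulrDl mul1r lerD// lef_pV2 ?posrE//; lra.
- rewrite -natr1 mulrDr lerD// ler_pdivrMr//; lra.
- split.
    rewrite mulrBr addrACA addr_ge0//.
  rewrite aS mulrBr addrACA mulrDr sqE.
  apply: (le_trans (lerD kdkN (lexx _))).
  rewrite -/a -subr_ge0 (_ : _ - _ =
     u * a * (a / 2) / ((u + a / 2) * (u + a) ^+ 2)).
    by rewrite divr_ge0 ?mulr_ge0 ?exprn_ge0//; lra.
  by field; rewrite !gt_eqF//; lra.
Qed.

(** A smooth substitute k for u |-> 1 / u, such that u k(u) is nearly constant on
    the logarithmic scale: u (u k)' is uniformly small. The usual substitute
    1 / (u + a) only gives u (u k)' <= 1 / 4; averaging it over N dyadic values of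
    a divides the bound by N, up to a constant. *)
Lemma slow_regularization (delta : R) : 0 < delta ->
  exists k dk : R -> R, forall u : R, 0 <= u ->
  [/\ is_derive u 1 k (dk u), {for u, continuous dk},
      (1 + u)^-1 <= k u, u * k u <= 1 &
      0 <= k u + u * dk u /\ u * (k u + u * dk u) <= delta].
Proof.
move=> delta0; set N := (Num.truncn (2 / delta)).+1.
have N0 : 0 < N%:R :> R by rewrite ltr0n.
have [k [dk kdk]] := dyadic_sum N.
exists (fun u => N%:R^-1 * k u), (fun u => N%:R^-1 * dk u) => u u0.
have [kD dkC k1 uk [kdk0 kdkN]] := kdk u u0.
split.
- apply: is_derive_eq (is_derive_mul (is_derive_cst _ _ _) kD) _.
  by rewrite mul0r add0r.
- apply: (@continuousM _ _ (fun=> _) dk) => //.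
  exact: cvg_cst.
- by rewrite mulrC ler_pdivlMr// mulrC.
- by rewrite mulrCA mulrC ler_pdivrMr// mul1r.
- have -> : N%:R^-1 * k u + u * (N%:R^-1 * dk u) = N%:R^-1 * (k u + u * dk u).
    by rewrite mulrDr mulrCA.
  split; first by rewrite mulr_ge0// invr_ge0 ltW.
  rewrite mulrCA mulrC ler_pdivrMr// (le_trans kdkN)//.
  have a0 : 0 < 2 ^- N :> R by rewrite invr_gt0 exprn_gt0.
  apply: (@le_trans _ _ 2); last first.
    by rewrite mulrC -ler_pdivrMr// ltW// /N truncnS_gt.
  by rewrite ler_piMr// ler_pdivrMr; lra.
Qed.

End SlowRegularization.

(** * Rigidity of divergence-free fields with proportional Laplacians *)

Section ContinuityOnPlane.
Context {R : realType}.
Implicit Types f g : R * R -> R.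

Lemma continuous_mul f g : continuous f -> continuous g ->
  continuous (fun p => f p * g p).
Proof. by move=> cf cg p; apply: (@continuousM _ _ f g); [exact: cf|exact: cg]. Qed.

Lemma continuous_add f g : continuous f -> continuous g ->
  continuous (fun p => f p + g p).
Proof. by move=> cf cg p; apply: (@continuousD _ _ _ f g); [exact: cf|exact: cg]. Qed.

Lemma continuous_opp f : continuous f -> continuous (fun p => - f p).
Proof. by move=> cf p; apply: (@continuousN _ _ _ f); exact: cf. Qed.

Lemma continuous_cst (c : R) : continuous (fun _ : R * R => c).
Proof. by move=> p; exact: cvg_cst. Qed.

Lemma continuous_ord : continuous (fun p : R * R => p.2).
Proof. by move=> p; exact: cvg_snd. Qed.

End ContinuityOnPlane.

(** Works on the syntax of the function: unifying with the closure lemmas blindly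
    would unfold the ring operations. *)
Ltac continuity :=
  lazymatch goal with
  | |- forall _, continuous_at _ (fun p => @Algebra.add _ (@?f p) (@?g p)) =>
      apply: (@continuous_add _ f g); continuity
  | |- forall _, continuous_at _ (fun p => @Algebra.opp _ (@?f p)) =>
      apply: (@continuous_opp _ f); continuity
  | |- forall _, continuous_at _ (fun p => @GRing.mul _ (@?f p) (@?g p)) =>
      apply: (@continuous_mul _ f g); continuity
  | |- _ => first [assumption | exact: continuous_cst | exact: continuous_ord]
  end.

Section Rigidity.
Context {R : realType}.

(** Derivatives are required inside the strip only; together with global
    continuity of f and g this encodes C^1 regularity up to the walls. *)
Definition dx (f g : R * R -> R) :=
  forall x y : R, -1 < y < 1 -> is_derive x 1 (fun t : R => f (t, y)) (g (x, y)).

Definition dy (f g : R * R -> R) :=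
  forall x y : R, -1 < y < 1 -> is_derive y 1 (fun t : R => f (x, t)) (g (x, y)).

Context {w v wx wy vx vy wxx wyy vxx vyy : R * R -> R}.
Hypotheses (cw : continuous w) (cv : continuous v) (cwx : continuous wx)
  (cwy : continuous wy) (cvx : continuous vx) (cvy : continuous vy)
  (cwxx : continuous wxx) (cwyy : continuous wyy) (cvxx : continuous vxx)
  (cvyy : continuous vyy).
Hypotheses (dwx : dx w wx) (dwy : dy w wy) (dvx : dx v vx) (dvy : dy v vy)
  (dwxx : dx wx wxx) (dwyy : dy wy wyy) (dvxx : dx vx vxx) (dvyy : dy vy vyy).
Hypothesis div0 : forall x y, -1 < y < 1 -> wx (x, y) = - vy (x, y).
Hypothesis slip0 : forall x, v (x, -1) = 0 /\ v (x, 1) = 0.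
Hypothesis laplacians : forall x y, -1 < y < 1 ->
  w (x, y) * (vxx (x, y) + vyy (x, y)) = v (x, y) * (wxx (x, y) + wyy (x, y)).
Context {M m : R}.
Hypotheses (M0 : 0 < M) (m0 : 0 < m).
Hypothesis w_bounded : forall x y, -1 < y < 1 -> `|w (x, y)| <= M.
Hypothesis v_bounded : forall x y, -1 < y < 1 -> `|v (x, y)| <= M.
Hypothesis nondegenerate : forall x y, -1 < y < 1 ->
  m <= `|w (x, y)| + `|wxx (x, y) + wyy (x, y)|.

Let itv_norm (y : R) : -1 < y < 1 -> `|y| <= 1.
Proof. by move=> ?; rewrite ler_norml; lra. Qed.

(** From w lap v = v lap w: where |w| >= m / 2 nothing has to be shown, and
    elsewhere |lap w| >= m / 2, so that |v| <= 2 |w| |lap v| / m. Hence the slope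
    v / w of the streamlines stays bounded across the zeros of w. *)
Lemma vertical_controlled L : exists2 K, 0 <= K & forall x y, `|x| <= L ->
  -1 < y < 1 -> `|v (x, y)| <= K * `|w (x, y)|.
Proof.
have cl : continuous (fun p => vxx p + vyy p) by continuity.
have [B B0 lB] := box_bounded cl L.
exists (2 * (B + M) / m) => [|x y xL y1].
  by rewrite divr_ge0// ?mulr_ge0// ?addr_ge0// ltW.
have := lB x y xL (itv_norm y1); have := v_bounded x y1; have := nondegenerate x y1.
have /(congr1 Num.norm) := laplacians x y1; rewrite !normrM.
move: `|vxx _ + _| `|wxx _ + _| `|v _| `|w _| (normr_ge0 (v (x, y)))
  (normr_ge0 (w (x, y))) => a b c d c0 d0 dacb mdb cM aB.
rewrite mulrAC ler_pdivlMr// -(ler_pM2l (ltr0n R 2)).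
have [dm|dm] := leP (m / 2) d; first nra.
have : c * (m / 2) <= c * b by rewrite ler_wpM2l//; lra.
have : d * a <= d * B by rewrite ler_wpM2l.
have : 0 <= M * d by rewrite mulr_ge0// ltW.
lra.
Qed.

(* The flux A = w grad v - v grad w = w^2 grad (v / w) is divergence free. *)
Let A1 p := w p * vx p - v p * wx p.
Let A2 p := w p * vy p - v p * wy p.

Let cA1 : continuous A1. Proof. by rewrite /A1; continuity. Qed.
Let cA2 : continuous A2. Proof. by rewrite /A2; continuity. Qed.

Let is_derive_sqr_comp (k dk : R -> R) (f : R -> R) (x df : R) :
  is_derive (f x ^+ 2) 1 k (dk (f x ^+ 2)) -> is_derive x 1 f df ->
  is_derive x 1 (fun t => k (f t ^+ 2)) (dk (f x ^+ 2) * (2 * f x * df)).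
Proof.
move=> kD fD; have f2 := is_derive_mul fD fD.
have -> : 2 * f x * df = df * f x + f x * df by ring.
exact: (@is_derive1_comp _ k (fun t => f t ^+ 2) x _ _ kD f2).
Qed.

(** Multiply div A = 0 by v / w and integrate over the cross-section. Formally
    E = int (v / w) A1 dy satisfies E' = int |A|^2 / w^2, and
    E^2 <= 2 M^2 E' by Cauchy-Schwarz because v is bounded. As v / w is not
    differentiable at the zeros of w, it is replaced by v w k(w^2) with k close to
    1 / u. The additional term in E' is
    2 v (k + w^2 k') A . grad w, and |v|, |A| are O(|w|), so it is bounded by
    w^2 (k + w^2 k'), which a slow regularization makes as small as desired. *)
Lemma flux_energy L eta : 0 < eta -> exists E dE : R -> R,
  (forall x : R, is_derive x 1 E (dE x)) /\
  forall x, `|x| <= L ->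
    strip_int (fun p => (A1 p ^+ 2 + A2 p ^+ 2) * (1 + w p ^+ 2)^-1) x - eta
      <= dE x /\
    (2 * M ^+ 2)^-1 * E x ^+ 2 - eta <= dE x.
Proof.
move=> eta0; have [K K0 vKw] := vertical_controlled L.
have [B1 B10 wxB] := box_bounded cwx L; have [B2 B20 wyB] := box_bounded cwy L.
have [B3 B30 vxB] := box_bounded cvx L; have [B4 B40 vyB] := box_bounded cvy L.
pose B := B1 + B2 + B3 + B4; pose C := 4 * K * (1 + K) * B ^+ 2.
have B0 : 0 <= B by rewrite !addr_ge0.
have C0 : 0 <= C by rewrite !mulr_ge0 ?addr_ge0 ?sqr_ge0//.
(* The additional term is at most C delta for w^2 (k + w^2 k') <= delta, and its
   integral over a cross-section of length 2 has to be at most eta. *)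
have [|k [dk kdk]] := @slow_regularization R (eta / (2 * (C + 1))).
  by rewrite divr_gt0// mulr_gt0//; lra.
pose kw p := k (w p ^+ 2); pose dkw p := dk (w p ^+ 2).
have w2 p : 0 <= w p ^+ 2 by exact: sqr_ge0.
have cw2 : continuous (fun p => w p ^+ 2) by exact: continuous_mul.
have ckw : continuous kw.
  move=> p; apply: (@continuous_comp _ _ _ (fun p => w p ^+ 2) k); first exact: cw2.
  by have [kD _ _ _ _] := kdk _ (w2 p); exact: is_derive_continuous kD.
have cdkw : continuous dkw.
  move=> p; apply: (@continuous_comp _ _ _ (fun p => w p ^+ 2) dk); first exact: cw2.
  by have [_ dkC _ _ _] := kdk _ (w2 p).
pose Q p := v p * w p * kw p.
pose Qx p := (vx p * w p + v p * wx p) * kw p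
             + v p * w p * (dkw p * (2 * w p * wx p)).
pose Qy p := (vy p * w p + v p * wy p) * kw p
             + v p * w p * (dkw p * (2 * w p * wy p)).
have cQ : continuous Q by rewrite /Q; continuity.
have cQx : continuous Qx by rewrite /Qx; continuity.
have cQy : continuous Qy by rewrite /Qy; continuity.
pose f1 p := Qx p * A1 p + Q p * (w p * vxx p - v p * wxx p).
pose f2 p := Qy p * A2 p + Q p * (w p * vyy p - v p * wyy p).
have cf1 : continuous f1 by rewrite /f1; continuity.
have cf2 : continuous f2 by rewrite /f2; continuity.
have cQA1 : continuous (fun p => Q p * A1 p) by continuity.
have cQA2 : continuous (fun p => Q p * A2 p) by continuity.
have dQx : dx Q Qx.
  move=> x y y1; have [kD _ _ _ _] := kdk _ (w2 (x, y)).
  apply: is_derive_mul; first by apply: is_derive_mul; [exact: dvx|exact: dwx].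
  exact: (is_derive_sqr_comp kD (dwx x y1)).
have dQy : dy Q Qy.
  move=> x y y1; have [kD _ _ _ _] := kdk _ (w2 (x, y)).
  apply: is_derive_mul; first by apply: is_derive_mul; [exact: dvy|exact: dwy].
  exact: (is_derive_sqr_comp kD (dwy x y1)).
have dF1 : dx (fun p => Q p * A1 p) f1.
  move=> x y y1; apply: is_derive_mul; first exact: dQx.
  apply: is_derive_eq (is_derive_sub
    (is_derive_mul (dwx x y1) (dvxx x y1)) (is_derive_mul (dvx x y1) (dwxx x y1))) _.
  by ring.
have dF2 : dy (fun p => Q p * A2 p) f2.
  move=> x y y1; apply: is_derive_mul; first exact: dQy.
  apply: is_derive_eq (is_derive_sub
    (is_derive_mul (dwy x y1) (dvyy x y1)) (is_derive_mul (dvy x y1) (dwyy x y1))) _.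
  by ring.
have If2 x : strip_int f2 x = 0.
  have [v0 v1] := slip0 x.
  by apply: (strip_int_dy cQA2 cf2) => [||y]; [rewrite /Q v0 !mul0r|
    rewrite /Q v1 !mul0r|exact: dF2].
pose S p := kw p * (A1 p ^+ 2 + A2 p ^+ 2).
pose bad p := 2 * v p * (kw p + w p ^+ 2 * dkw p) * (A1 p * wx p + A2 p * wy p).
have cA12 : continuous (fun p => A1 p ^+ 2 + A2 p ^+ 2).
  by apply: continuous_add; exact: continuous_mul.
have cS : continuous S by exact: continuous_mul.
(* Adding f2 = d/dy (Q A2), whose integral vanishes, to f1 = d/dx (Q A1). *)
have key x y : -1 < y < 1 ->
    f1 (x, y) + f2 (x, y) = S (x, y) + bad (x, y).
  move=> y1; have := laplacians x y1.
  rewrite /f1 /f2 /S /bad /Q /Qx /Qy /A1 /A2.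
  move: (w _) (v _) (wx _) (wy _) (vx _) (vy _) (wxx _) (wyy _) (vxx _) (vyy _)
    (kw _) (dkw _) => a b ax ay bx by_ axx ayy bxx byy q dq lap.
  rewrite -[RHS](addr0) -[X in _ = _ + X](mulr0 (b * a * q)).
  rewrite (_ : 0 = a * (bxx + byy) - b * (axx + ayy)); last by rewrite lap subrr.
  by ring.
have badle x y : `|x| <= L -> -1 < y < 1 -> `|bad (x, y)| <= eta / 2.
  move=> xL y1; have y1' := itv_norm y1.
  have [_ _ _ _ [kge kle]] := kdk _ (w2 (x, y)).
  have vK := vKw x y xL y1.
  have BB (z b : R) : `|z| <= b -> b <= B -> `|z| <= B by move=> /le_trans; apply.
  have {}wxB : `|wx (x, y)| <= B by apply: BB (wxB x y xL y1') _; rewrite /B; lra.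
  have {}wyB : `|wy (x, y)| <= B by apply: BB (wyB x y xL y1') _; rewrite /B; lra.
  have {}vxB : `|vx (x, y)| <= B by apply: BB (vxB x y xL y1') _; rewrite /B; lra.
  have {}vyB : `|vy (x, y)| <= B by apply: BB (vyB x y xL y1') _; rewrite /B; lra.
  have flux (a b : R) : `|a| <= B -> `|b| <= B ->
      `|w (x, y) * a - v (x, y) * b| <= (1 + K) * B * `|w (x, y)|.
    move=> aB bB; rewrite (le_trans (ler_normB _ _))// !normrM.
    have : `|w (x, y)| * `|a| <= `|w (x, y)| * B by rewrite ler_wpM2l.
    have : `|v (x, y)| * `|b| <= K * `|w (x, y)| * B by rewrite ler_pM.
    by move=> ? ?; lra.
  have grad : `|A1 (x, y) * wx (x, y) + A2 (x, y) * wy (x, y)|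
      <= 2 * (1 + K) * B ^+ 2 * `|w (x, y)|.
    rewrite (le_trans (ler_normD _ _))// !normrM.
    have : `|A1 (x, y)| * `|wx (x, y)| <= (1 + K) * B * `|w (x, y)| * B.
      by rewrite ler_pM// flux.
    have : `|A2 (x, y)| * `|wy (x, y)| <= (1 + K) * B * `|w (x, y)| * B.
      by rewrite ler_pM// flux.
    by move=> ? ?; lra.
  rewrite /bad !normrM (ger0_norm kge) (ger0_norm (ler0n R 2)).
  apply: (@le_trans _ _ (C * (w (x, y) ^+ 2 * (kw (x, y) + w (x, y) ^+ 2 * dkw (x, y))))).
    rewrite -[X in C * (X * _)](real_normK (num_real (w (x, y)))).
    move: (kw _ + _) kge => q q0.
    have := ler_pM (normr_ge0 _) (normr_ge0 _) vK grad.
    move=> /(ler_wpM2l (mulr_ge0 (ler0n R 2) q0)).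
    by rewrite /C; lra.
  apply: (le_trans (ler_wpM2l C0 kle)).
  rewrite invfM !mulrA ler_pdivrMr; last by lra.
  have : 0 <= eta / 2 by lra.
  by lra.
have SdE x : `|x| <= L -> strip_int S x - eta <= strip_int f1 x.
  move=> xL.
  have -> : strip_int f1 x = strip_int (fun p => f1 p + f2 p) x.
    by rewrite (strip_intD x cf1 cf2) If2 addr0.
  have -> : - eta = - (eta / 2) * 2 by lra.
  rewrite -(strip_int_cst (- (eta / 2)) x).
  rewrite -(strip_intD x cS (@continuous_cst R _)).
  apply: le_strip_int; [by continuity..|].
  move=> y y1; rewrite key//.
  by have := badle x y xL y1; rewrite ler_norml; lra.
exists (strip_int (fun p => Q p * A1 p)), (strip_int f1); split.
  exact: is_derive_strip_int.
move=> x xL; split; apply: (le_trans _ (SdE x xL)); rewrite lerD2r.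
  apply: le_strip_int => //.
    apply: continuous_mul => // p.
    apply: (@continuousV _ _ (fun p => 1 + w p ^+ 2)).
      by rewrite gt_eqF// ltr_pwDl.
    by apply: continuous_add => //; exact: continuous_cst.
  move=> y y1; rewrite mulrC ler_wpM2r ?addr_ge0 ?sqr_ge0//.
  by have [_ _ ? _ _] := kdk _ (w2 (x, y)).
rewrite mulrC ler_pdivrMr ?mulr_gt0 ?exprn_gt0//.
apply: (le_trans (sqr_strip_int_le _ _)) => //.
suff : strip_int (fun p => (Q p * A1 p) ^+ 2) x <= M ^+ 2 * strip_int S x by lra.
rewrite -(strip_intZ _ x cS).
apply: le_strip_int; [exact: continuous_mul|by continuity|].
move=> y y1; have [_ _ kge uk _] := kdk _ (w2 (x, y)).
have k0 : 0 <= kw (x, y) by apply: le_trans kge; rewrite invr_ge0 addr_ge0.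
rewrite /S /Q !exprMn.
have v2 : v (x, y) ^+ 2 <= M ^+ 2.
  by rewrite -real_normK ?num_real// lerXn2r ?nnegrE ?(ltW M0)//; exact: v_bounded.
have := sqr_ge0 (A1 (x, y)); have := sqr_ge0 (A2 (x, y)).
have -> : v (x, y) ^+ 2 * w (x, y) ^+ 2 * kw (x, y) ^+ 2 * A1 (x, y) ^+ 2 =
  (v (x, y) ^+ 2 * (w (x, y) ^+ 2 * kw (x, y))) * (kw (x, y) * A1 (x, y) ^+ 2) by ring.
move=> A2ge A1ge; apply: ler_pM.
- exact: mulr_ge0 (sqr_ge0 _) (mulr_ge0 (sqr_ge0 _) k0).
- exact: mulr_ge0 k0 A1ge.
- rewrite -[leRHS]mulr1; apply: ler_pM => //; first exact: sqr_ge0.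
  exact: mulr_ge0 (sqr_ge0 _) k0.
- by rewrite ler_wpM2l// lerDl.
Qed.

(** Since A1 = w v_x + v v_y and A2 = - (w w_x + v w_y) for a divergence-free
    field, this says that the pressure gradient vanishes: fluid particles move
    along straight lines. *)
Lemma flux_eq0 x y : -1 < y < 1 ->
  w (x, y) * vx (x, y) = v (x, y) * wx (x, y) /\
  w (x, y) * vy (x, y) = v (x, y) * wy (x, y).
Proof.
move=> y1.
have cf : continuous (fun p => (A1 p ^+ 2 + A2 p ^+ 2) * (1 + w p ^+ 2)^-1).
  apply: continuous_mul; first by apply: continuous_add; exact: continuous_mul.
  move=> p; apply: (@continuousV _ _ (fun p => 1 + w p ^+ 2)).
    by rewrite gt_eqF// ltr_pwDl ?sqr_ge0.
  by apply: continuous_add; [exact: continuous_cst|exact: continuous_mul].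
have k0 : 0 < (2 * M ^+ 2)^-1 by rewrite invr_gt0 mulr_gt0 ?exprn_gt0.
have f0 (s t : R) : -1 < t < 1 ->
    0 <= (A1 (s, t) ^+ 2 + A2 (s, t) ^+ 2) * (1 + w (s, t) ^+ 2)^-1.
  by move=> _; rewrite mulr_ge0 ?invr_ge0 ?addr_ge0 ?sqr_ge0.
have /eqP := riccati_liouville k0 cf f0 flux_energy x y1.
rewrite mulf_eq0 invr_eq0 [X in _ || X]gt_eqF ?ltr_pwDl ?sqr_ge0// orbF.
rewrite paddr_eq0 ?sqr_ge0// !sqrf_eq0 /A1 /A2 !subr_eq0.
by move=> /andP[/eqP-> /eqP->].
Qed.

(** Without pressure gradient, G = int y w v dy satisfies G' = int v^2, because
    y (w v)_x = - 2 y v v_y = v^2 - (y v^2)_y, and G^2 <= 2 M^2 G' as w is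
    bounded. So G obeys a Riccati inequality on the whole line. *)
Theorem vertical_velocity_eq0 x y : -1 < y < 1 -> v (x, y) = 0.
Proof.
move=> y1.
have cv2 : continuous (fun p => v p ^+ 2) by exact: continuous_mul.
have k0 : 0 < (2 * M ^+ 2)^-1 by rewrite invr_gt0 mulr_gt0 ?exprn_gt0.
suff /eqP : v (x, y) ^+ 2 = 0 by rewrite sqrf_eq0 => /eqP.
apply: (riccati_liouville k0 cv2) y1 => [*|L eta eta0]; first exact: sqr_ge0.
pose F p := p.2 * (w p * v p).
pose f p := p.2 * (wx p * v p + w p * vx p).
pose g p := v p ^+ 2 + p.2 * (vy p * v p + v p * vy p).
have cF : continuous F by rewrite /F; continuity.
have cf : continuous f by rewrite /f; continuity.
have cg : continuous g by rewrite /g; apply: continuous_add => //; continuity.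
have Ig t : strip_int g t = 0.
  have [v0 v1] := slip0 t.
  have cG : continuous (fun p : R * R => p.2 * (v p * v p)) by continuity.
  apply: (strip_int_dy cG cg) => [||s s1] /=; rewrite ?v0 ?v1 ?mulr0//.
  apply: is_derive_eq (is_derive_mul (is_derive_id s 1)
    (is_derive_mul (dvy t s1) (dvy t s1))) _.
  by rewrite mul1r.
have If t : strip_int f t = strip_int (fun p => v p ^+ 2) t.
  rewrite -[LHS]addr0 -(Ig t) -(strip_intD t cf cg); apply: eq_strip_int => s s1.
  have [e1 _] := flux_eq0 t s1; rewrite /f /g /= e1 div0//; ring.
exists (strip_int F), (strip_int f); split => [t|t tL].
  apply: is_derive_strip_int => // t' s s1.
  apply: is_derive_eq (is_derive_mul (is_derive_cst s t' 1)
    (is_derive_mul (dwx t' s1) (dvx t' s1))) _.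
  by rewrite mul0r add0r.
rewrite If; split; first by rewrite lerBlDr lerDl ltW.
apply: (@le_trans _ _ ((2 * M ^+ 2)^-1 * strip_int F t ^+ 2)).
  by rewrite lerBlDr lerDl ltW.
rewrite mulrC ler_pdivrMr ?mulr_gt0 ?exprn_gt0//.
apply: (le_trans (sqr_strip_int_le _ _)) => //.
suff : strip_int (fun p => F p ^+ 2) t <= M ^+ 2 * strip_int (fun p => v p ^+ 2) t.
  by lra.
rewrite -(strip_intZ _ t cv2).
apply: le_strip_int; [exact: continuous_mul|by continuity|].
move=> s s1; rewrite /F /= !exprMn mulrA ler_wpM2r ?sqr_ge0//.
rewrite -[leRHS]mul1r ler_pM ?sqr_ge0//.
  by rewrite -subr_ge0 (_ : _ - _ = (1 - s) * (1 + s)) ?mulr_ge0//; [lra..|ring].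
by rewrite -real_normK ?num_real// lerXn2r ?nnegrE ?(ltW M0)//; exact: w_bounded.
Qed.

End Rigidity.

(** * Regularity up to the walls and steady flows *)

Section StripRegularity.
Context {R : realType}.
Implicit Types f g h : R * R -> R.

Lemma Omega_Omega_bar (p : R * R) : Omega p -> Omega_bar p.
Proof. by rewrite /Omega /Omega_bar /= => /andP[? ?]; rewrite !ltW. Qed.

(** Composition with the retraction of the plane onto the closed strip. Working
    with functions that are continuous on the whole plane removes every
    restricted continuity statement from the integral calculus. *)
Lemma continuous_clamp_extension h : {within Omega_bar (R:=R), continuous h} ->
  exists2 g, continuous g & forall p, Omega_bar p -> g p = h p.
Proof.
move=> /subspace_continuousP ch.
pose clamp (y : R) := Num.max (-1) (Num.min y 1).
have cclamp : continuous clamp.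
  move=> y; refine (@continuous_max R R (fun=> -1) _ y _ _).
    exact: cvg_cst.
  refine (@continuous_min R R id (fun=> 1) y _ _); first exact: cvg_id.
  exact: cvg_cst.
pose phi (p : R * R) := (p.1, clamp p.2).
have cphi : continuous phi.
  move=> p; apply: (@cvg_pair _ _ _ _ (nbhs p.1) (nbhs (clamp p.2))).
    exact: cvg_fst.
  apply: (@continuous_comp _ _ _ snd clamp); first exact: cvg_snd.
  exact: cclamp.
have phi_bar p : Omega_bar (phi p).
  by rewrite /Omega_bar/= /clamp le_max lexx/= ge_max ge_min lexx orbT andbT; lra.
exists (h \o phi) => [p U /(ch _ (phi_bar p)) hU|[x y]]; last first.
  rewrite /Omega_bar/= /phi/= /clamp => /andP[y1 y2].
  by rewrite (min_idPl y2) (max_idPr y1).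
by apply: (@filterS _ (nbhs p) _ _ _ _ (cphi p _ hU)) => q /=; apply; exact: phi_bar.
Qed.

Lemma extends_continuously_extension g : extends_continuously g ->
  exists2 h, continuous h & forall p, Omega p -> h p = g p.
Proof.
move=> [h [/continuous_clamp_extension[k ck kh] hg]]; exists k => // p Op.
by rewrite kh ?hg//; exact: Omega_Omega_bar.
Qed.

Lemma dx_pd1 f h g : (forall p, Omega p -> pderivable f p) ->
  (forall p, Omega p -> h p = f p) -> (forall p, Omega p -> g p = pd1 f p) ->
  dx h g.
Proof.
move=> df hf gf x y y1.
rewrite (_ : (fun t : R => h (t, y)) = (fun t : R => f (t, y))); last first.
  by apply/funext => t; exact: hf.
rewrite (gf (x, y) y1); exact: derivable_is_derive (df (x, y) y1).1.
Qed.

Lemma near_Omega (y : R) : -1 < y < 1 -> \forall t \near y, -1 < t < 1.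
Proof.
by move=> y1; have /near_in_itvoo : y \in `]-1, 1[ by rewrite in_itv.
Qed.

Lemma dy_pd2 f h g : (forall p, Omega p -> pderivable f p) ->
  (forall p, Omega p -> h p = f p) -> (forall p, Omega p -> g p = pd2 f p) ->
  dy h g.
Proof.
move=> df hf gf x y y1; rewrite (gf (x, y) y1).
have D : is_derive y 1 (fun t : R => f (x, t)) (pd2 f (x, y)).
  exact: derivable_is_derive (df (x, y) y1).2.
apply: near_eq_is_derive D; near=> t; rewrite hf//=.
by rewrite /Omega/=; near: t; exact: near_Omega.
Unshelve. all: by end_near. Qed.

Lemma C1_extension f h : C1_up_to_boundary f -> (forall p, Omega p -> h p = f p) ->
  exists hx hy, [/\ continuous hx, continuous hy,
    forall p, Omega p -> hx p = pd1 f p /\ hy p = pd2 f p, dx h hx & dy h hy].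
Proof.
move=> [df /extends_continuously_extension[hx chx hxE]
  /extends_continuously_extension[hy chy hyE]] hf.
exists hx, hy; split => //.
- by move=> p Op; rewrite hxE// hyE.
- exact: (dx_pd1 df).
- exact: (dy_pd2 df).
Qed.

(** f itself need not be continuous: the mean value theorem is applied to
    increments of f along the axes, so that the pressure, of which only the two
    partial derivatives are known, is covered. *)
Lemma schwarz f fx fy fxy fyx : dx f fx -> dy f fy -> dy fx fxy -> dx fy fyx ->
  continuous fxy -> continuous fyx ->
  forall x y, -1 < y < 1 -> fxy (x, y) = fyx (x, y).
Proof.
move=> dfx dfy dfxy dfyx cxy cyx x y y1; apply/eqP/negPn/negP => neq.
pose d := `|fxy (x, y) - fyx (x, y)| / 2.
have d0 : 0 < d by rewrite divr_gt0// normr_gt0 subr_eq0.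
have nearby g : continuous g -> exists2 e : R, 0 < e & forall s t : R,
    `|s - x| < e -> `|t - y| < e -> `|g (x, y) - g (s, t)| < d.
  move=> cg; have cgp : g p @[p --> (x, y)] --> g (x, y) by exact: cg.
  have : \forall p \near (x, y), `|g (x, y) - g p| < d.
    exact: cvgr_dist_lt cgp _ d0.
  move=> /nbhs_ballP[e /= e0 be].
  exists e => // s t sx ty; apply: be; split.
    by rewrite /ball/= distrC.
  by rewrite /ball/= distrC.
have [e1 e10 near1] := nearby _ cxy; have [e2 e20 near2] := nearby _ cyx.
have [r [r0 re1 re2 ry]] : exists r, [/\ 0 < r, r < e1, r < e2 & y + r < 1].
  exists (Num.min (e1 / 2) (Num.min (e2 / 2) ((1 - y) / 2))).
  rewrite !lt_min !gt_min; split; first by apply/and3P; split; lra.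
  - by apply/orP; left; lra.
  - by apply/orP; right; apply/orP; left; lra.
  - have : Num.min (e1 / 2) (Num.min (e2 / 2) ((1 - y) / 2)) <= (1 - y) / 2.
      by rewrite !ge_min lexx !orbT.
    lra.
have y1' t : y <= t <= y + r -> -1 < t < 1 by move=> /andP[? ?]; apply/andP; lra.
have yr : -1 < y + r < 1 by apply/andP; lra.
have xr : x < x + r by rewrite ltrDl.
have yr' : y < y + r by rewrite ltrDl.
(* the increment of f over the square, computed in both orders *)
have [a /andP[ax ax']] := MVT_real xr
  (fun s _ => is_derive_sub (dfx s _ yr) (dfx s _ y1)).
have [b /andP[yb yb'] ->] := MVT_real yr' (fun t ht => dfxy a t (y1' t ht)).
have [b' /andP[yb1 yb1']] := MVT_real yr'
  (fun t ht => is_derive_sub (dfy (x + r) _ (y1' t ht)) (dfy x _ (y1' t ht))).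
have y1b : -1 < b' < 1 by apply: y1'; rewrite !ltW.
have [a' /andP[xa xa'] ->] := MVT_real xr (fun s _ => dfyx s _ y1b).
rewrite ![_ + r - _]addrAC !subrr !add0r => sq2 sq1.
have {sq1 sq2} : fxy (a, b) * r * r = fyx (a', b') * r * r by lra.
have rn0 : r != 0 by rewrite gt_eqF.
move=> /(mulIf rn0)/(mulIf rn0) eqr.
have := near1 a b; have := near2 a' b'.
rewrite !ltr_norml => h2 h1.
have {}h1 : - d < fxy (x, y) - fxy (a, b) < d by apply: h1; apply/andP; lra.
have {}h2 : - d < fyx (x, y) - fyx (a', b') < d by apply: h2; apply/andP; lra.
have : `|fxy (x, y) - fyx (x, y)| < 2 * d by rewrite ltr_norml; lra.
by rewrite /d mulrC divfK// ltxx.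
Qed.

Lemma continuous_eq0_closed (phi : R -> R) : continuous phi ->
  (forall y, -1 < y < 1 -> phi y = 0) -> forall y, -1 <= y <= 1 -> phi y = 0.
Proof.
move=> cphi phi0 y y1; apply/eqP/negPn/negP => /eqP nz.
have n0 : 0 < `|phi y| by rewrite normr_gt0; exact/eqP.
have cp : phi t @[t --> y] --> phi y by exact: cphi.
have : \forall t \near y, `|phi y - phi t| < `|phi y|.
  exact: cvgr_dist_lt cp _ n0.
move=> /nbhs_ballP[e /= e0 be].
pose q := Num.min (e / 2) (1 / 2).
have q0 : 0 < q by rewrite lt_min; apply/andP; lra.
have qe : q <= e / 2 by rewrite ge_min lexx.
have q1 : q <= 1 / 2 by rewrite ge_min lexx orbT.
have inside : -1 < y * (1 - q) < 1.
  rewrite -ltr_norml normrM (@le_lt_trans _ _ `|1 - q|)//.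
    by rewrite ler_piMl// ler_norml.
  by rewrite gtr0_norm; lra.
suff /be : ball y e (y * (1 - q)) by rewrite (phi0 _ inside) subr0 ltxx.
rewrite /ball/= (_ : _ - _ = y * q); last by ring.
rewrite normrM (gtr0_norm q0) (@le_lt_trans _ _ q)//; last by lra.
by rewrite ler_piMl ?(ltW q0)// ler_norml.
Qed.

(** The common core of both parts, in the frame that moves with speed c.
    Incompressibility turns the momentum equations into grad P = (A2, - A1) for
    the flux A, and the symmetry of the second derivatives of P is exactly
    div A = 0, that is w lap v = v lap w. *)
Theorem steady_rigidity (c M m : R) (v1 v2 P : R * R -> R) :
  C2_closed_strip v1 -> C2_closed_strip v2 -> slip v2 -> div_free v1 v2 ->
  (forall x, Omega x ->
    [/\ pderivable P x,
        (v1 x - c) * pd1 v1 x + v2 x * pd2 v1 x + pd1 P x = 0 &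
        (v1 x - c) * pd1 v2 x + v2 x * pd2 v2 x + pd2 P x = 0]) ->
  0 < m -> (forall x, Omega x -> `|v1 x - c| <= M) ->
  (forall x, Omega x -> `|v2 x| <= M) ->
  (forall x, Omega x ->
    m <= `|v1 x - c| + `|pd1 (pd1 v1) x + pd2 (pd2 v1) x|) ->
  shear_flow v1 v2.
Proof.
move=> [/continuous_clamp_extension[a ca aE] a1 a11 a12].
move=> [/continuous_clamp_extension[v cv vE] b1 b11 b12].
move=> slip2 div2 euler m0 bnd1 bnd2 nondeg.
have aO p : Omega p -> a p = v1 p by move=> /Omega_Omega_bar /aE.
have vO p : Omega p -> v p = v2 p by move=> /Omega_Omega_bar /vE.
have [ax [ay [cax cay aD dax day]]] := C1_extension a1 aO.
have [vx [vy [cvx cvy vD dvx dvy]]] := C1_extension b1 vO.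
have [axx [axy [caxx _ axD daxx _]]] := C1_extension a11 (fun p Op => (aD p Op).1).
have [ayx [ayy [_ cayy ayD _ dayy]]] := C1_extension a12 (fun p Op => (aD p Op).2).
have [vxx [vxy [cvxx _ _ dvxx _]]] := C1_extension b11 (fun p Op => (vD p Op).1).
have [vyx [vyy [_ cvyy _ _ dvyy]]] := C1_extension b12 (fun p Op => (vD p Op).2).
pose w p := a p - c.
have cw : continuous w by apply: continuous_add => //; exact: continuous_cst.
have dwx : dx w ax.
  move=> x y y1; apply: is_derive_eq (is_derive_sub (dax x y y1) (is_derive_cst c x 1)) _.
  by rewrite subr0.
have dwy : dy w ay.
  move=> x y y1; apply: is_derive_eq (is_derive_sub (day x y y1) (is_derive_cst c y 1)) _.
  by rewrite subr0.
have div0 x y : -1 < y < 1 -> ax (x, y) = - vy (x, y).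
  move=> y1; have [-> _] := aD (x, y) y1; have [_ ->] := vD (x, y) y1.
  by apply/eqP; rewrite -addr_eq0; apply/eqP; exact: div2.
have slip0 x : v (x, -1) = 0 /\ v (x, 1) = 0.
  rewrite !vE /Omega_bar/= ?lexx ?andbT; try lra.
  by split; apply: slip2; [left|right].
have dPx : dx P (fun p => w p * vy p - v p * ay p).
  move=> x y y1; have [[dP _] e1 _] := euler (x, y) y1.
  apply: is_derive_eq (derivable_is_derive dP) _.
  rewrite -[derive1 _ _]/(pd1 P (x, y)); move: e1.
  have [<- <-] := aD (x, y) y1; rewrite -aO// -vO// div0// /w; lra.
have dPy : dy P (fun p => v p * ax p - w p * vx p).
  move=> x y y1; have [[_ dP] _ e2] := euler (x, y) y1.
  apply: is_derive_eq (derivable_is_derive dP) _.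
  rewrite -[derive1 _ _]/(pd2 P (x, y)); move: e2.
  have [<- <-] := vD (x, y) y1; rewrite -aO// -vO// div0// /w; lra.
have dPxy : dy (fun p => w p * vy p - v p * ay p) (fun p => w p * vyy p - v p * ayy p).
  move=> x y y1; apply: is_derive_eq (is_derive_sub
    (is_derive_mul (dwy x y y1) (dvyy x y y1)) (is_derive_mul (dvy x y y1) (dayy x y y1))) _.
  by ring.
have dPyx : dx (fun p => v p * ax p - w p * vx p) (fun p => v p * axx p - w p * vxx p).
  move=> x y y1; apply: is_derive_eq (is_derive_sub
    (is_derive_mul (dvx x y y1) (daxx x y y1)) (is_derive_mul (dwx x y y1) (dvxx x y y1))) _.
  by ring.
have laplacians x y : -1 < y < 1 ->
    w (x, y) * (vxx (x, y) + vyy (x, y)) = v (x, y) * (axx (x, y) + ayy (x, y)).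
  have cxy : continuous (fun p => w p * vyy p - v p * ayy p) by continuity.
  have cyx : continuous (fun p => v p * axx p - w p * vxx p) by continuity.
  by move=> y1; have := schwarz dPx dPy dPxy dPyx cxy cyx x y1; lra.
have v0 x y : -1 < y < 1 -> v (x, y) = 0.
  apply: (vertical_velocity_eq0 cw cv cax cay cvx cvy caxx cayy cvxx cvyy
    dwx dwy dvx dvy daxx dayy dvxx dvyy div0 slip0 laplacians
    (M := `|M| + 1) _ m0).
  - by rewrite ltr_wpDl.
  - move=> s t t1; rewrite /w aO//; have := bnd1 (s, t) t1.
    have := ler_norm M; lra.
  - move=> s t t1; rewrite vO//; have := bnd2 (s, t) t1.
    have := ler_norm M; lra.
  - move=> s t t1; have := nondeg (s, t) t1.
    by have [-> _] := axD (s, t) t1; have [_ ->] := ayD (s, t) t1; rewrite /w aO.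
have a_const x y : -1 < y < 1 -> a (x, y) = a (0, y).
  move=> y1; apply: (@is_derive_0_is_cst R (fun t => a (t, y))) => t.
  apply: is_derive_eq (dax t y y1) _.
  rewrite div0//.
  have D : is_derive y 1 (fun s : R => v (t, s)) 0.
    apply: near_eq_is_derive (is_derive_cst (0 : R) y 1).
    near=> s; rewrite v0//; near: s; exact: near_Omega.
  by rewrite -(is_derive_derive1 (dvy t y y1)) (is_derive_derive1 D) oppr0.
exists (fun y => a (0, y)) => -[x y] /= y1; split.
  rewrite -aE//; apply/eqP; rewrite -subr_eq0; apply/eqP.
  apply: (@continuous_eq0_closed (fun y => a (x, y) - a (0, y))) => //.
    move=> t; apply: (@continuousB _ _ _ (fun y => a (x, y)) (fun y => a (0, y)));
      exact: continuous_vslice.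
  by move=> t t1; rewrite a_const// subrr.
move: y1; rewrite /Omega_bar/= !le_eqVlt => /andP[/predU1P[<- _|y0]].
  by apply: slip2; left.
move=> /predU1P[->|y1]; first by apply: slip2; right.
by rewrite -vO ?v0// /Omega/= y0 y1.
Unshelve. all: by end_near. Qed.

End StripRegularity.

(** * Essential bounds of continuous functions *)

Section EssentialBound.
Context {R : realType}.
Notation mu2 := (@lebesgue_measure R \x @lebesgue_measure R)%E.

Lemma box_measure_gt0 (x y r : R) : 0 < r ->
  (0 < mu2 ([set` `](x - r)%R, (x + r)%R[] `*` [set` `](y - r)%R, (y + r)%R[]))%E.
Proof.
move=> r0; rewrite product_measure1E; [|exact: measurable_itv..].
have itv0 (a : R) : (0 < lebesgue_measure [set` `](a - r)%R, (a + r)%R[])%E.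
  by rewrite lebesgue_measure_itv/= lte_fin ifT ?lte_fin; lra.
exact: mule_gt0 (itv0 x) (itv0 y).
Qed.

(** If |h| > C at a point of the open strip, then |h| > C on a box, which has
    positive measure. *)
Lemma Linf_norm_le (f h : R * R -> R) (C : R) : (Linf_norm f <= C%:E)%E ->
  continuous h -> (forall p, Omega p -> h p = f p) ->
  forall p, Omega p -> `|f p| <= C.
Proof.
move=> fC ch hf [x y] xyO; rewrite leNgt; apply/negP => Cf.
have cp : h p @[p --> (x, y)] --> h (x, y) by exact: ch.
have cn : `|h p| @[p --> (x, y)] --> `|h (x, y)| by exact: cvg_norm.
have : \forall p \near (x, y), C < `|h p|.
  by apply: (cvgr_gt _ cn); rewrite hf.
move=> /nbhs_ballP[e /= e0 be].
have /andP[y1 y2] := xyO; rewrite /= in y1 y2.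
have [r [r0 re ry ry']] : exists r, [/\ 0 < r, r < e, y + r < 1 & -1 < y - r].
  exists (Num.min (e / 2) (Num.min ((1 - y) / 2) ((1 + y) / 2))).
  set r := Num.min _ _.
  have r1 : r <= e / 2 by rewrite /r ge_min lexx.
  have r2 : r <= (1 - y) / 2 by rewrite /r !ge_min lexx orbT.
  have r3 : r <= (1 + y) / 2 by rewrite /r !ge_min lexx !orbT.
  by split; [rewrite !lt_min; apply/and3P; split; lra|lra..].
pose Box := [set` `]x - r, x + r[] `*` [set` `]y - r, y + r[].
have Box0 : (0 < mu2 Box)%E by exact: box_measure_gt0.
have mBox : measurable Box by apply: measurableX; exact: measurable_itv.
have muT : (0 < mu2 setT)%E.
  by apply: (lt_le_trans Box0); apply: le_measure; rewrite ?inE.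
move: fC; rewrite /Linf_norm unlock muT => /ess_supP[N [mN N0 sub]].
suff : (mu2 Box <= mu2 N)%E by rewrite N0 leNgt Box0.
apply: le_measure; rewrite ?inE// => -[s t] [/=]; rewrite !in_itv/= => sx ty.
apply: sub => /=; rewrite patchE mem_set; last by rewrite /Omega/=; lra.
rewrite lee_fin; apply/negP; rewrite -ltNge -hf; last by rewrite /Omega/=; lra.
by apply: be; split; rewrite /ball/= /ball/= ltr_norml; lra.
Qed.

Lemma Linf_norm_ge0 (f : R * R -> R) : (0 <= Linf_norm f)%E.
Proof. exact: Lnorm_ge0. Qed.

End EssentialBound.

(** * Travelling waves and structural stability *)

Section Corollary.
Context {R : realType}.
Implicit Types f h v : R * R -> R.

Lemma Linf_norm_lt (f h : R * R -> R) (C : \bar R) : (Linf_norm f < C)%E ->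
  continuous h -> (forall p, Omega p -> h p = f p) ->
  exists2 r : R, (r%:E < C)%E & forall p, Omega p -> `|f p| <= r.
Proof.
move=> fC ch hf; have f0 := Linf_norm_ge0 f.
have fr : (fine (Linf_norm f))%:E = Linf_norm f.
  by rewrite fineK// ge0_fin_numE// (lt_le_trans fC)// leey.
exists (fine (Linf_norm f)); first by rewrite fr.
by apply: (Linf_norm_le _ ch hf); rewrite fr.
Qed.

Lemma segment_extension (g : R -> R) : {within `[-1, 1], continuous g} ->
  exists2 k : R * R -> R, continuous k & forall p, Omega_bar p -> k p = g p.2.
Proof.
move=> /subspace_continuousP cg; apply: continuous_clamp_extension.
apply/subspace_continuousP => -[x y] y1 U /cg.
have {}y1 : `[-1, 1]%classic y by rewrite /= in_itv.
move=> /(_ y1) gU.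
have cs : (fun p : R * R => p.2) @ (x, y) --> y by exact: cvg_snd.
apply: (@filterS _ (nbhs (x, y)) _ _ _ _ (cs _ gU)) => -[s t] /= h t1.
by apply: h; rewrite in_itv.
Qed.

Lemma C2_segment_extension (s s1 s2 : R -> R) : C2_segment s s1 s2 ->
  exists k k2 : R * R -> R, [/\ continuous k, continuous k2,
    forall p, Omega_bar p -> k p = s p.2 & forall p, Omega_bar p -> k2 p = s2 p.2].
Proof.
move=> [cs _ cs2 _ _].
by have [k ck kE] := segment_extension cs; have [k2 ck2 k2E] := segment_extension cs2;
  exists k, k2.
Qed.

Lemma min_segment_le (g : R -> R) : {within `[-1, 1], continuous g} ->
  forall y, -1 <= y <= 1 -> min_segment g <= g y.
Proof.
move=> cg y y1; have [|c _ cmin] := @EVT_min R g (-1) 1 _ cg; first by lra.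
apply: ge_inf; last by exists y => //=; rewrite in_itv.
by exists (g c) => _ [t /= t1 <-]; exact: cmin.
Qed.

Lemma is_derive_travelling (c : R) f (x : R * R) : Omega x -> pderivable f x ->
  derive1 (fun r : R => travelling c f r x) 0 = - c * pd1 f x.
Proof.
move=> Ox [fx _]; apply: is_derive_derive1.
pose g (r : R) := x.1 - c * r.
have g0 : g 0 = x.1 by rewrite /g mulr0 subr0.
have gD : is_derive (0 : R) 1 g (- c).
  apply: is_derive_eq (is_derive_sub (is_derive_cst x.1 (0 : R) 1)
    (is_derive_mul (is_derive_cst c (0 : R) 1) (is_derive_id (0 : R) 1))) _.
  by rewrite mul0r !add0r mulr1.
have fD : is_derive (g 0) 1 (fun t : R => f (t, x.2)) (pd1 f x).
  by rewrite g0; exact: derivable_is_derive.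
by apply: is_derive_eq (is_derive1_comp fD gD) _; rewrite mulrC.
Qed.

Lemma travelling0 (c : R) f : travelling c f 0 = f.
Proof. by apply/funext => -[x y]; rewrite /travelling mulr0 subr0. Qed.

(** Here lap v1 = - d2 omega, by incompressibility and the symmetry of the second
    derivatives of v2. The smallness of d2 (omega - omega_sh) therefore
    keeps lap v1 above a positive constant, whatever the zeros of v1 - c are. *)
Theorem travelling_rigidity (s s1 s2 : R -> R) (c : R) v1 v2 :
  C2_segment s s1 s2 -> 0 < min_segment s2 ->
  C2_closed_strip v1 -> C2_closed_strip v2 ->
  (Linf_norm v1 < +oo)%E -> (Linf_norm v2 < +oo)%E -> slip v2 ->
  unsteady_euler (travelling c v1) (travelling c v2) ->
  (Linf_norm (pd2 (fun x : R * R => (vorticity v1 v2 x - (- s1 x.2))%R))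
     < (min_segment s2)%:E)%E ->
  shear_flow v1 v2.
Proof.
move=> hs smin C1 C2 bnd1 bnd2 slip2 [/(_ 0) div2 [P euler]] vort.
rewrite !travelling0 in div2.
have [_ _ cs2 _ ds1] := hs; have [_ [k2 [_ ck2 _ k2E]]] := C2_segment_extension hs.
have [/continuous_clamp_extension[a ca aE] a1 a11 a12] := C1.
have [/continuous_clamp_extension[b cb bE] b1 b11 b12] := C2.
have [M1 _ v1M] := Linf_norm_lt bnd1 ca (fun p Op => aE p (Omega_Omega_bar Op)).
have [M2 _ v2M] := Linf_norm_lt bnd2 cb (fun p Op => bE p (Omega_Omega_bar Op)).
have [bx [by_ [cbx cby bD dbx dby]]] :=
  C1_extension b1 (fun p Op => bE p (Omega_Omega_bar Op)).
have [bxx [bxy [cbxx cbxy bxD dbxx dbxy]]] := C1_extension b11 (fun p Op => (bD p Op).1).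
have [byx [byy [cbyx cbyy byD dbyx dbyy]]] := C1_extension b12 (fun p Op => (bD p Op).2).
have [ax [ay [cax cay aD dax day]]] :=
  C1_extension a1 (fun p Op => aE p (Omega_Omega_bar Op)).
have [axx [axy [caxx caxy axD daxx daxy]]] := C1_extension a11 (fun p Op => (aD p Op).1).
have [ayx [ayy [cayx cayy ayD dayx dayy]]] := C1_extension a12 (fun p Op => (aD p Op).2).
pose D p := bxy p - ayy p + k2 p.
have cD : continuous D by rewrite /D; continuity.
have DE p : Omega p ->
    D p = pd2 (fun x : R * R => vorticity v1 v2 x - (- s1 x.2)) p.
  move=> Op; apply/esym/is_derive_derive1.
  have [[b11d _ _] [a12d _ _]] := (b11, a12).
  have [_ d1] := b11d p Op; have [_ d2] := a12d p Op.
  apply: is_derive_eq (is_derive_sub (is_derive_sub (derivable_is_derive d1)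
    (derivable_is_derive d2)) (is_deriveN (ds1 _ Op))) _.
  rewrite opprK /D k2E; last exact: Omega_Omega_bar.
  by have [_ ->] := bxD p Op; have [_ ->] := ayD p Op.
have [r rmin Dr] := Linf_norm_lt vort cD DE.
apply: (@steady_rigidity R c (M1 + `|c| + M2) (min_segment s2 - r) v1 v2 (P 0)) => //.
- move=> x Ox; have := euler 0 x Ox; rewrite !travelling0.
  have [[a1d _ _] [b1d _ _]] := (a1, b1).
  rewrite (is_derive_travelling _ Ox (a1d x Ox)).
  rewrite (is_derive_travelling _ Ox (b1d x Ox)) => -[dP e1 e2].
  by split; [exact: dP|clear -e1; lra|clear -e2; lra].
- by rewrite subr_gt0 -lte_fin.
- move=> x Ox; have := v1M x Ox; have := le_trans (normr_ge0 _) (v2M x Ox).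
  by have := ler_normB (v1 x) c; lra.
- move=> x Ox; have := v2M x Ox; have := le_trans (normr_ge0 _) (v1M x Ox).
  by have := normr_ge0 c; lra.
- move=> [x y] Ox; have sy := min_segment_le cs2 (Omega_Omega_bar Ox).
  have mixed : bxy (x, y) = byx (x, y).
    exact: schwarz dbx dby dbxy dbyx cbxy cbyx x y Ox.
  have lap1 : pd1 (pd1 v1) (x, y) = - byx (x, y).
    apply: is_derive_derive1.
    rewrite (_ : (fun t => _) = (fun t : R => - by_ (t, y))).
      exact: is_deriveN (dbyx x y Ox).
    apply/funext => t; have [_ ->] := bD (t, y) Ox.
    by apply/eqP; rewrite -addr_eq0; apply/eqP/div2.
  have [_ lap2] := ayD (x, y) Ox.
  have := Dr _ Ox; rewrite -DE// /D (k2E _ (Omega_Omega_bar Ox)) lap1 -lap2 mixed /=.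
  rewrite ler_norml => /andP[_ Dle].
  have := ler_norm (- byx (x, y) + ayy (x, y)).
  by have := normr_ge0 (v1 (x, y) - c); lra.
Qed.

Lemma ge0_summands_le (A B C D E G x : \bar R) :
  (0 <= A -> 0 <= B -> 0 <= C -> 0 <= D -> 0 <= E -> 0 <= G ->
   A + B + C + D + E + G <= x -> [/\ A <= x, B <= x, D <= x & G <= x])%E.
Proof.
move=> A0 B0 C0 D0 E0 G0 le_x; split; apply: le_trans le_x.
- by rewrite -!addeA leeDl// !adde_ge0.
- by rewrite [(A + B)%E]addeC -!addeA leeDl// !adde_ge0.
- by rewrite [(A + B + C + D)%E]addeC -!addeA leeDl// !adde_ge0.
- by rewrite leeDr// !adde_ge0.
Qed.

(** By compactness |s| + |s''| >= m > 0 on the segment. A perturbation of size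
    m / 4 of s, of d11 and of d22 takes away at most 3 m / 4 of this bound, and v2
    is small because d2 v2 = - d1 (v1 - s) and v2 vanishes on the wall. *)
Theorem structural_stability (s s1 s2 : R -> R) : C2_segment s s1 s2 ->
  (forall y, -1 <= y <= 1 -> s y = 0 -> s2 y <> 0) ->
  exists eps0 : R, 0 < eps0 /\
    forall v1 v2 : R * R -> R, C2_closed_strip v1 -> C2_closed_strip v2 ->
    steady_euler v1 v2 -> slip v2 ->
    (W2inf_norm (fun x : R * R => (v1 x - s x.2)%R) <= eps0%:E)%E ->
    shear_flow v1 v2.
Proof.
move=> hs nondeg; have [_ _ _ ds ds1] := hs.
have [k [k2 [ck ck2 kE k2E]]] := C2_segment_extension hs.
have [m [m0 mle]] : exists m, 0 < m /\
    forall y, -1 < y < 1 -> m <= `|s y| + `|s2 y|.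
  pose phi y := `|k (0, y)| + `|k2 (0, y)|.
  have phiE y : -1 <= y <= 1 -> phi y = `|s y| + `|s2 y|.
    by move=> y1; rewrite /phi kE ?k2E.
  have cphi : continuous phi.
    have cn f : continuous f -> continuous (fun y => `|f (0, y)|).
      by move=> cf y; apply: cvg_norm; exact: continuous_vslice.
    move=> y; apply: (@continuousD _ _ _ (fun y => `|k (0, y)|)
      (fun y => `|k2 (0, y)|)); exact: cn.
  have [|y0 y01 ymin] := @EVT_min R phi (-1) 1 _ (continuous_subspaceT cphi).
    by lra.
  rewrite in_itv/= in y01; exists (phi y0); split.
    rewrite phiE// lt_neqAle addr_ge0// andbT eq_sym paddr_eq0// !normr_eq0.
    by apply/negP => /andP[/eqP sy /eqP]; exact: nondeg.
  move=> y /andP[y1 y2]; have y11 : -1 <= y <= 1 by rewrite !ltW.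
  by rewrite -(phiE _ y11); apply: ymin; rewrite in_itv.
have [S S0 kS] := box_bounded ck 0.
exists (m / 4); split; first by lra.
move=> v1 v2 C1 C2 [div2 [P euler]] slip2 close.
have [/continuous_clamp_extension[a ca aE] a1 a11 a12] := C1.
have [/continuous_clamp_extension[b cb bE] b1 _ _] := C2.
have [bx [by_ [cbx cby bD dbx dby]]] :=
  C1_extension b1 (fun p Op => bE p (Omega_Omega_bar Op)).
have [ax [ay [cax cay aD dax day]]] :=
  C1_extension a1 (fun p Op => aE p (Omega_Omega_bar Op)).
have [axx [axy [caxx caxy axD daxx daxy]]] := C1_extension a11 (fun p Op => (aD p Op).1).
have [ayx [ayy [cayx cayy ayD dayx dayy]]] := C1_extension a12 (fun p Op => (aD p Op).2).
set F := fun x : R * R => v1 x - s x.2 in close.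
have [[a1d _ _] [a11d _ _] [a12d _ _]] := And3 a1 a11 a12.
have F1 p : Omega p -> pd1 F p = pd1 v1 p.
  move=> Op; have [d _] := a1d p Op; apply: is_derive_derive1.
  apply: is_derive_eq (is_derive_sub (derivable_is_derive d)
    (is_derive_cst (s p.2) p.1 1)) _.
  by rewrite subr0.
have F2 p : Omega p -> pd2 F p = pd2 v1 p - s1 p.2.
  move=> Op; have [_ d] := a1d p Op; apply: is_derive_derive1.
  exact: is_derive_sub (derivable_is_derive d) (ds _ Op).
have F11 p : Omega p -> pd1 (pd1 F) p = pd1 (pd1 v1) p.
  case: p => x y Op; rewrite [LHS]/pd1/=; congr (derive1 _ x).
  by apply/funext => t; exact: F1.
have F22 p : Omega p -> pd2 (pd2 F) p = pd2 (pd2 v1) p - s2 p.2.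
  case: p => x y Op; have [_ d] := a12d (x, y) Op; apply: is_derive_derive1.
  apply: near_eq_is_derive (is_derive_sub (derivable_is_derive d) (ds1 _ Op)).
  by near=> t; rewrite F2// /Omega/=; near: t; exact: near_Omega.
have [n0 n1 n11 n22] : [/\ (Linf_norm F <= (m / 4)%:E)%E,
    (Linf_norm (pd1 F) <= (m / 4)%:E)%E,
    (Linf_norm (pd1 (pd1 F)) <= (m / 4)%:E)%E &
    (Linf_norm (pd2 (pd2 F)) <= (m / 4)%:E)%E].
  by apply: ge0_summands_le close; exact: Linf_norm_ge0.
have e0 p : Omega p -> `|F p| <= m / 4.
  have cF : continuous (fun p => a p - k p) by continuity.
  by apply: (Linf_norm_le n0 cF) => q Oq; rewrite aE ?kE//; exact: Omega_Omega_bar.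
have e1 p : Omega p -> `|pd1 F p| <= m / 4.
  apply: (Linf_norm_le n1 cax) => q Oq.
  by rewrite (F1 q Oq); exact: (aD q Oq).1.
have e11 p : Omega p -> `|pd1 (pd1 F) p| <= m / 4.
  apply: (Linf_norm_le n11 caxx) => q Oq.
  by rewrite (F11 q Oq); exact: (axD q Oq).1.
have e22 p : Omega p -> `|pd2 (pd2 F) p| <= m / 4.
  have cF : continuous (fun p => ayy p - k2 p) by continuity.
  apply: (Linf_norm_le n22 cF) => q Oq; rewrite F22// k2E; last exact: Omega_Omega_bar.
  by have [_ ->] := ayD q Oq.
have v2le p : Omega p -> `|v2 p| <= m / 2.
  case: p => x y Oxy; have /andP[y1 y2] := Oxy; rewrite /= in y1 y2.
  have [||t t1] := @MVT R (fun t => b (x, t)) (fun t => by_ (x, t)) (-1) y y1.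
  - move=> t; rewrite in_itv/= => /andP[? ?]; apply: dby; apply/andP; lra.
  - exact/continuous_subspaceT/continuous_vslice.
  have Ot : Omega (x, t).
    by move: t1; rewrite in_itv/= /Omega/= => /andP[? ?]; apply/andP; lra.
  rewrite !bE /Omega_bar/=; [|lra|lra].
  rewrite (slip2 (x, -1)); last by left.
  rewrite subr0 => ->; have [_ ->] := bD _ Ot.
  have -> : pd2 v2 (x, t) = - pd1 v1 (x, t).
    by apply/eqP; rewrite -addr_eq0 addrC; apply/eqP/div2.
  have := e1 _ Ot; rewrite F1// normrM normrN => h.
  have : `|pd1 v1 (x, t)| * `|y - -1| <= m / 4 * 2.
    by rewrite ler_pM// ger0_norm; lra.
  by lra.
apply: (@steady_rigidity R 0 (S + m) (m / 4) v1 v2 P) => //.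
- by move=> x Ox; have := euler x Ox; rewrite subr0.
- by lra.
- move=> [x y] Oxy; have := e0 _ Oxy; rewrite /F/=.
  have : `|s y| <= S.
    have := kS 0 y; rewrite normr0 lexx kE/=; last exact: (Omega_Omega_bar Oxy).
    apply=> //; move: Oxy; rewrite /Omega/= ler_norml; lra.
  rewrite subr0; have := ler_normD (v1 (x, y) - s y) (s y); rewrite subrK; lra.
- by move=> x Ox; have := v2le x Ox; lra.
- move=> [x y] Oxy; have := e0 _ Oxy; have := e11 _ Oxy; have := e22 _ Oxy.
  rewrite F11// F22// /F/= subr0; have := mle y Oxy.
  move: (pd1 (pd1 v1) _) (pd2 (pd2 v1) _) (v1 _) (s y) (s2 y) => p q z sy ty h.
  have := ler_normD (sy - z) z; rewrite subrK (distrC sy z).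
  have := ler_normD (ty - q) q; rewrite subrK (distrC ty q).
  by have := ler_normB (p + q) p; rewrite [p + q]addrC addrK; lra.
Unshelve. all: by end_near. Qed.

End Corollary.

Theorem corollary1p6 (R : realType) (s s1 s2 : R -> R)
    (hs : C2_segment s s1 s2) :
  (0 < min_segment s2 ->
   forall (c : R) (v1 v2 : R * R -> R),
     C2_closed_strip v1 -> C2_closed_strip v2 ->
     (Linf_norm v1 < +oo)%E -> (Linf_norm v2 < +oo)%E ->
     slip v2 ->
     unsteady_euler (travelling c v1) (travelling c v2) ->
     (Linf_norm (pd2 (fun x : R * R => (vorticity v1 v2 x - (- s1 x.2))%R))
        < (min_segment s2)%:E)%E ->
     shear_flow v1 v2)
  /\
  (finite_set [set y : R | (-1 <= y <= 1) /\ s y = 0] ->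
   (forall y : R, -1 <= y <= 1 -> s y = 0 -> s2 y <> 0) ->
   exists eps0 : R, 0 < eps0 /\
     forall v1 v2 : R * R -> R,
       C2_closed_strip v1 -> C2_closed_strip v2 ->
       steady_euler v1 v2 ->
       slip v2 ->
       (W2inf_norm (fun x : R * R => (v1 x - s x.2)%R) <= eps0%:E)%E ->
       shear_flow v1 v2).
Proof.
split=> [smin c v1 v2 C1 C2 bnd1 bnd2 slip2 euler vort|_ nondeg].
  exact: (travelling_rigidity hs smin C1 C2 bnd1 bnd2 slip2 euler vort).
exact: (structural_stability hs nondeg).
Qed.
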